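(* Let $n$ be even and let $G$ be a directed graph on $[n]$ consisting of a collection of $n/2$ vertex-disjoint 2-cycles, described by a fixed-point-free involution $\pi$ of $[n]$, together with a self loop at every vertex, with all edges labeled by distinct non-commuting variables. Then any non-commutative algebraic branching program computing the Cayley permanent of $G$ has size at least $2^{\Omega({\sf cut}(G))}$.
   Context: Polynomials live in the free (non-commutative) algebra over an arbitrary field $\mathbb{K}$. A non-commutative algebraic branching program is a directed acyclic graph with distinguished nodes $s,t$, edges labeled by variables or field constants, computing the sum over all $s\leadsto t$ paths of the product of edge labels in path order; size is the number of nodes. The Cayley permanent of $G$ is $\sum_{\sigma\in S_n}x_{1,\sigma(1)}\cdots x_{n,\sigma(n)}$ (product in this order), where $x_{i,j}$ is the label of edge $(i,j)$ and $0$ if there is no such edge. For $1\le i\le n$, $C_i(\pi)$ is the set of transpositions $\{j,\pi(j)\}$ of $\pi$ with $\min(j,\pi(j))\le i\le\max(j,\pi(j))$, and ${\sf cut}(G)={\sf cut}(\pi)=\max_{1\le k\le n}|C_k(\pi)|$. *)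

(* Defs.v *)
From HB Require Import structures.
From mathcomp Require Import all_boot all_order all_fingroup all_algebra.
From mathcomp Require Import reals exp.
From mathcomp Require Import monalg.

Set Implicit Arguments.
Unset Strict Implicit.
Unset Printing Implicit Defensive.

Import Order.TTheory GRing.Theory Num.Theory.

Local Open Scope ring_scope.

(* Monomials are words over [X], with concatenation as product. *)
Notation freealg K X := {malg K[{fmonom X}]}.

Definition ncvar (K : fieldType) (X : choiceType) (x : X) : freealg K X :=
  << fmu x >>.

(* [node] and [edge] are separate types, so parallel edges are allowed. *)
Record abp (K : fieldType) (X : choiceType) := ABP {
  node : finType;
  edge : finType;
  src : edge -> node;
  tgt : edge -> node;
  label : edge -> X + K;
  source : node;
  sink : node;
  _ : forall e : edge,
        ~~ connect (fun u v => [exists f, (src f == u) && (tgt f == v)])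
             (tgt e) (src e)
}.

Section ABPSemantics.
Variables (K : fieldType) (X : choiceType) (P : abp K X).

Definition label_poly (a : X + K) : freealg K X :=
  match a with
  | inl x => ncvar K x
  | inr c => c%:MP
  end.

Fixpoint walk (u v : node P) (p : seq (edge P)) : bool :=
  if p is e :: p' then (src e == u) && walk (tgt e) v p' else u == v.

Lemma walk_size u v p : walk u v p -> (size p < #|node P|)%N.
Proof.
pose step (a b : node P) := [exists f : edge P, (src f == a) && (tgt f == b)].
have acyc (e : edge P) : ~~ connect step (tgt e) (src e).
  by rewrite /step; case: P e.
have walk_connect a b q (c : node P) :
    walk a b q -> c \in a :: map (@tgt _ _ P) q -> connect step a c.
  elim: q a => [|e q IHq] a /=.
    by move=> _; rewrite inE => /eqP->; apply: connect0.
  case/andP=> /eqP<- w; rewrite inE => /orP[/eqP->|cq]; first exact: connect0.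
  apply: connect_trans (IHq _ w cq); apply: connect1.
  by apply/existsP; exists e; rewrite !eqxx.
have walk_uniq a b q : walk a b q -> uniq (a :: map (@tgt _ _ P) q).
  elim: q a => [|e q IHq] a //=.
  case/andP=> /eqP<- w; have /= -> := IHq _ w; rewrite andbT.
  exact: contra (walk_connect _ _ _ _ w) (acyc e).
move=> /walk_uniq /card_uniqP cu.
have := max_card (mem (u :: map (@tgt _ _ P) p)).
by rewrite cu /= size_map.
Qed.

(* By [walk_size] the bound on the length excludes no path. *)
Definition abp_poly : freealg K X :=
  \sum_(l < #|node P|)
    \sum_(p : l.-tuple (edge P) | walk (source P) (sink P) p)
      \prod_(e <- p) label_poly (label e).

Definition abp_size : nat := #|node P|.

End ABPSemantics.

Definition cayley_perm (K : fieldType) (X : choiceType) (n : nat)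
    (G : rel 'I_n) (x : 'I_n -> 'I_n -> X) : freealg K X :=
  \sum_(s : {perm 'I_n})
    \prod_(i < n) (if G i (s i) then ncvar K (x i (s i)) else 0).

Definition loops_and_2cycles (n : nat) (pi : {perm 'I_n}) : rel 'I_n :=
  fun i j => (j == i) || (j == pi i).

Definition distinct_labels (X : choiceType) (n : nat) (G : rel 'I_n)
    (x : 'I_n -> 'I_n -> X) : Prop :=
  forall i j k l, G i j -> G k l -> x i j = x k l -> i = k /\ j = l.

(* Vertices, and hence cut positions, are numbered from 0. *)
Definition cut_at (n : nat) (pi : {perm 'I_n}) (i : 'I_n) : {set {set 'I_n}} :=
  [set [set j; pi j] | j : 'I_n
     & (pi j != j) && (minn j (pi j) <= i <= maxn j (pi j))%N].

Definition cut (n : nat) (pi : {perm 'I_n}) : nat :=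
  (\max_(k < n) #|cut_at pi k|)%N.

(* Main.v *)
(* For a gap between positions [m - 1] and [m], consider the permutations that
   swap exactly the pairs in a set [T] of transpositions crossing the gap, and
   split their words at the gap. The prefix of [T] and the suffix of [T']
   concatenate to a monomial of the Cayley permanent iff [T = T'], so this
   submatrix of the coefficient matrix is an identity matrix. Its rank is at
   most the number of nodes, because the polynomials computed from the nodes to
   the sink span a space closed under left quotients by letters. Some gap is
   crossed by [cut pi] transpositions, so [c = 1] works. *)

Require Import Defs.
From mathcomp Require Import all_boot all_order all_fingroup all_algebra.
From mathcomp Require Import reals exp.
From mathcomp Require Import monalg.

Set Implicit Arguments.
Unset Strict Implicit.
Unset Printing Implicit Defensive.

Import Order.TTheory GRing.Theory Num.Theory.

Local Open Scope ring_scope.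

(** * Coefficients of words in the free algebra *)

Section FreeAlgebra.
Variables (K : fieldType) (X : choiceType).

Lemma mcoeff_ncvarM (x y : X) (w : seq X) (g : freealg K X) :
  (ncvar K y * g)@_(FMonom (x :: w)) = g@_(FMonom w) *+ (y == x).
Proof.
rewrite [g]monalgE mulr_sumr !raddf_sum /= -sumrMnl; apply: eq_bigr => k _.
rewrite malgM_def fgmulUU mul1r !mcoeffU -mulrnA mulnb; congr (_ *+ _).
by rewrite -!(inj_eq val_inj) /= fmM fmU /= eqseq_cons andbC.
Qed.

Lemma prod_ncvar (I : Type) (r : seq I) (f : I -> X) :
  \prod_(i <- r) ncvar K (f i) = << FMonom (map f r) >>.
Proof.
elim: r => [|i r IHr].
  by rewrite big_nil; congr << _ >>; apply: val_inj; rewrite /= fm1.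
rewrite big_cons IHr malgM_def fgmulUU mul1r; congr << _ >>.
by apply: val_inj; rewrite /= fmM fmU.
Qed.

End FreeAlgebra.

(** * Nisan's rank bound for branching programs *)

Section BranchingProgram.
Variables (K : fieldType) (X : choiceType) (P : abp K X).

Definition walk_poly (l : nat) (a : node P) : freealg K X :=
  \sum_(p : l.-tuple (edge P) | walk a (sink P) p)
    \prod_(e <- p) label_poly (label e).

(** The value at [source P] is [abp_poly P] by definition; other start nodes serve the recursion. *)
Definition node_poly (a : node P) : freealg K X :=
  \sum_(l < #|node P|) walk_poly l a.

Lemma walk_poly0 a : walk_poly 0 a = (a == sink P)%:R.
Proof.
rewrite /walk_poly big_mkcond /= (bigD1 [tuple]) //= big_nil big1 ?addr0 => [|p].
  by case: eqP.
by rewrite [p]tuple0 => /negP[].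
Qed.

Lemma walk_polyS l a :
  walk_poly l.+1 a =
  \sum_(e | src e == a) label_poly (label e) * walk_poly l (tgt e).
Proof.
rewrite /walk_poly; under [RHS]eq_bigr do rewrite mulr_sumr.
rewrite pair_big_dep /=.
rewrite (reindex (fun q : edge P * l.-tuple (edge P) => cons_tuple q.1 q.2)) /=.
  by apply: eq_bigr => q _; rewrite big_cons.
exists (fun p : l.+1.-tuple (edge P) => (thead p, behead_tuple p))
  => [[e p]|p] _.
  by congr pair; apply: val_inj.
by rewrite [RHS]tuple_eta; apply: val_inj.
Qed.

Lemma walk_poly_max a : walk_poly #|node P| a = 0.
Proof.
rewrite /walk_poly big_pred0 // => p; apply/negP => /walk_size.
by rewrite size_tuple ltnn.
Qed.

Lemma node_poly_rec a :
  node_poly a = (a == sink P)%:R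
    + \sum_(e | src e == a) label_poly (label e) * node_poly (tgt e).
Proof.
(* The added length contributes 0 by [walk_poly_max]; it leaves the full range of lengths once the
   first edge is split off. *)
transitivity (\sum_(l < #|node P|.+1) walk_poly l a).
  by rewrite big_ord_recr /= walk_poly_max addr0.
rewrite big_ord_recl walk_poly0; congr (_ + _).
under eq_bigr do rewrite walk_polyS; rewrite exchange_big /=.
by apply: eq_bigr => e _; rewrite mulr_sumr.
Qed.

Let step (u v : node P) := [exists f : edge P, (src f == u) && (tgt f == v)].

(** By acyclicity the source of [e] is lost from the reachable set. This is the measure for
    recursion along constant edges, which consume no letter. *)
Lemma reach_decr (e : edge P) :
  (#|connect step (tgt e)| < #|connect step (src e)|)%N.
Proof.
have acyc : ~~ connect step (tgt e) (src e) by rewrite /step; case: (P) e.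
apply: proper_card; apply/properP; split.
  apply/subsetP => v; apply: connect_trans; apply: connect1.
  by apply/existsP; exists e; rewrite !eqxx.
by exists (src e); [exact: connect0 | exact: acyc].
Qed.

(* The span of the node polynomials is closed under left quotients by a letter:
   variable edges are consumed, constant edges are followed recursively. *)
Lemma letter_quotient (x : X) (a : node P) :
  exists al : node P -> K, forall w,
    (node_poly a)@_(FMonom (x :: w)) = \sum_b al b * (node_poly b)@_(FMonom w).
Proof.
have [k] := ubnP #|connect step a|; elim: k a => // k IHk a leka.
have quot_edge (e : edge P) : exists al : node P -> K, src e == a -> forall w,
    (label_poly (label e) * node_poly (tgt e))@_(FMonom (x :: w)) =
    \sum_b al b * (node_poly b)@_(FMonom w).
  (* [fin_all_exists] needs coefficients for every edge, so edges not leaving [a] get 0. *)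
  case: (boolP (src e == a)) => [/eqP sea|_]; last by exists (fun=> 0).
  have /IHk[al alP] : (#|connect step (tgt e)| < k)%N.
    by apply: leq_trans (reach_decr e) _; rewrite sea.
  case: (label e) => [y|c] /=.
    exists (fun b => ((y == x) && (b == tgt e))%:R) => _ w.
    rewrite mcoeff_ncvarM (bigD1 (tgt e)) //= big1 ?addr0 => [|b /negPf->].
      by rewrite eqxx andbT mulr_natl.
    by rewrite andbF mul0r.
  exists (fun b => c * al b) => _ w; rewrite mcoeffCM alP mulr_sumr.
  by apply: eq_bigr => b _; rewrite mulrA.
have [al alP] := fin_all_exists quot_edge.
exists (fun b => \sum_(e | src e == a) al e b) => w.
rewrite node_poly_rec mcoeffD raddf_sum /=.
(* The empty walk contributes nothing at the nonempty word [x :: w]. *)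
rewrite mcoeffMn mcoeff1 -(inj_eq val_inj) /= fm1 mul0rn add0r.
under [RHS]eq_bigr do rewrite mulr_suml.
rewrite exchange_big /=; apply: eq_bigr => e sea; exact: alP.
Qed.

Lemma word_quotient (u : seq X) (a : node P) :
  exists al : node P -> K, forall v,
    (node_poly a)@_(FMonom (u ++ v)) = \sum_b al b * (node_poly b)@_(FMonom v).
Proof.
elim: u a => [|x u IHu] a.
  exists (fun b => (b == a)%:R) => v.
  rewrite (bigD1 a) //= big1 ?addr0 ?eqxx ?mul1r // => b /negPf->.
  by rewrite mul0r.
have [be beP] := letter_quotient x a; have [al alP] := fin_all_exists IHu.
exists (fun b => \sum_c be c * al c b) => v; rewrite beP.
under eq_bigr do rewrite alP mulr_sumr.
rewrite exchange_big; apply: eq_bigr => b _ /=; rewrite mulr_suml.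
by apply: eq_bigr => c _; rewrite mulrA.
Qed.

(* Nisan's bound: the matrix of coefficients of [abp_poly P] at the words
   [u i ++ v j] factors through the nodes. *)
Lemma abp_size_ge_fooling (I : finType) (u v : I -> seq X) :
  (forall i j, (abp_poly P)@_(FMonom (u i ++ v j)) = (i == j)%:R) ->
  (#|I| <= abp_size P)%N.
Proof.
move=> uvP.
have [al alP] := fin_all_exists (fun i => word_quotient (u i) (source P)).
pose A := \matrix_(r < #|I|, b < #|node P|) al (enum_val r) (enum_val b).
pose B := \matrix_(b < #|node P|, r < #|I|)
  (node_poly (enum_val b))@_(FMonom (v (enum_val r))).
have AB : A *m B = 1%:M.
  apply/matrixP => r s; rewrite !mxE -(inj_eq enum_val_inj) -uvP alP.
  rewrite [RHS](reindex (@enum_val _ (node P))) /=; last first.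
    exact/onW_bij/enum_val_bij.
  by apply: eq_bigr => b _; rewrite !mxE.
by rewrite -(mxrank1 K #|I|) -AB mulmx_max_rank.
Qed.

End BranchingProgram.

(** * Transpositions crossing a gap, and the permutations swapping some of them *)

Section Matching.
Variables (n : nat) (pi : {perm 'I_n}).
Hypotheses (piK : forall i, pi (pi i) = i) (pi_neq : forall i, pi i != i).

(** Each transposition crossing the gap just before [m] is represented by its smaller endpoint. *)
Definition crossing (m : nat) : {set 'I_n} := [set j : 'I_n | j < m <= pi j]%N.

(* [k] is itself an endpoint of a transposition: the gap just after [k] is
   crossed by all of [cut_at pi k] if [k] is the smaller one, the gap just
   before [k] if it is the larger one. *)
Lemma cut_at_crossing (k : 'I_n) :
  exists m, (#|cut_at pi k| <= #|crossing m|)%N.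
Proof.
exists (if k < pi k then k.+1 else k)%N.
have sub : cut_at pi k \subset
    [set [set j; pi j] | j in crossing (if k < pi k then k.+1 else k)%N].
  have cross (j : 'I_n) : (j < pi j)%N -> (j <= k <= pi j)%N ->
      j \in crossing (if k < pi k then k.+1 else k)%N.
    move=> jltpj /andP[jk kpj]; rewrite inE; case: ifP => kpk.
      rewrite ltnS jk ltn_neqAle kpj andbT; apply/eqP => /val_inj kE.
      by move: kpk; rewrite kE piK ltnNge ltnW.
    rewrite kpj andbT ltn_neqAle jk andbT; apply/eqP => /val_inj jE.
    by move: kpk; rewrite -jE jltpj.
  apply/subsetP => _ /imsetP[j jk ->]; move: jk; rewrite inE pi_neq /=.
  case: (ltngtP j (pi j)) => [lt|lt|/val_inj eq] jk.
  - by apply: imset_f; apply: cross; rewrite ?lt.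
  - rewrite setUC -{2}(piK j); apply: imset_f.
    by apply: cross; rewrite ?piK.
  - by have := pi_neq j; rewrite -eq eqxx.
exact: leq_trans (subset_leq_card sub) (leq_imset_card _ _).
Qed.

(** Testing both [j] and [pi j] makes the condition invariant under [pi], so every [T] yields an
    involution. *)
Definition swap_fun (T : {set 'I_n}) (j : 'I_n) : 'I_n :=
  if (j \in T) || (pi j \in T) then pi j else j.

Lemma swap_funK T : involutive (swap_fun T).
Proof.
rewrite /swap_fun => j; case h: ((j \in T) || (pi j \in T)); last by rewrite h.
by rewrite piK orbC h.
Qed.

Definition swap (T : {set 'I_n}) : {perm 'I_n} := perm (inv_inj (@swap_funK T)).

Lemma swapE T j : swap T j = if (j \in T) || (pi j \in T) then pi j else j.
Proof. by rewrite permE. Qed.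

Lemma swap_graph T i : loops_and_2cycles pi i (swap T i).
Proof. by rewrite /loops_and_2cycles swapE; case: ifP; rewrite eqxx ?orbT. Qed.

(** Since [pi j] lies beyond the gap, it is not in [T]. Hence either side of the gap alone reveals
    whether the pair of [j] is swapped. *)
Lemma swap_crossing m (T : {set 'I_n}) j :
  T \subset crossing m -> j \in crossing m ->
  (swap T j == pi j) = (j \in T) /\ (swap T (pi j) == j) = (j \in T).
Proof.
move=> /subsetP sT; rewrite inE => /andP[jm mpj].
have pjT : pi j \notin T.
  by apply/negP => /sT; rewrite inE ltnNge mpj.
rewrite !swapE piK (negPf pjT) orbF /=.
by case: (j \in T); rewrite ?eqxx // 1?eq_sym (negPf (pi_neq j)).
Qed.

End Matching.

(** * Monomials of the Cayley permanent *)

Section CayleyPermanent.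
Variables (K : fieldType) (X : choiceType) (n : nat).
Variables (G : rel 'I_n) (x : 'I_n -> 'I_n -> X).
Hypothesis x_inj : distinct_labels G x.

(** Distinct labels let the word determine [f], so at most one permutation contributes. [f] is any
    map along edges because glued words need not come from a permutation. *)
Lemma mcoeff_cayley_perm (f : 'I_n -> 'I_n) : (forall i, G i (f i)) ->
  (cayley_perm K G x)@_(FMonom [seq x i (f i) | i <- enum 'I_n]) =
  [exists s : {perm 'I_n}, [forall i, s i == f i]]%:R.
Proof.
move=> Gf; rewrite raddf_sum /=.
have term (s : {perm 'I_n}) :
    (\prod_(i < n) (if G i (s i) then ncvar K (x i (s i)) else 0))
      @_(FMonom [seq x i (f i) | i <- enum 'I_n]) = [forall i, s i == f i]%:R.
  have [/forallP Gs|/forallPn[i nGi]] := boolP [forall i, G i (s i)].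
    under eq_bigr do rewrite Gs.
    rewrite [index_enum _]unlock -enumT prod_ncvar mcoeffU1 -(inj_eq val_inj) /=; congr (_%:R).
    congr nat_of_bool; apply/eqP/forallP => [/eq_in_map sf i|sf].
      by have [_ ->] := x_inj (Gs i) (Gf i) (sf i (mem_enum _ i)).
    by apply: eq_map => i; rewrite (eqP (sf i)).
  have [/forallP sf|_] := boolP [forall i, s i == f i].
    by rewrite (eqP (sf i)) Gf in nGi.
  suff -> : \prod_(i < n) (if G i (s i) then ncvar K (x i (s i)) else 0) = 0.
    exact: mcoeff0.
  (* The product is noncommutative, so the zero factor is reached by induction along the list. *)
  have := mem_index_enum i; elim: (index_enum _) => //= j r IHr.
  rewrite inE big_cons => /predU1P[<-|/IHr->]; last by rewrite mulr0.
  by rewrite (negPf nGi) mul0r.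
under eq_bigr do rewrite term.
have [/existsP[s sf]|/existsPn nf] :=
  boolP [exists s : {perm 'I_n}, [forall i, s i == f i]]; last first.
  by apply: big1 => s _; rewrite (negPf (nf s)).
rewrite (bigD1 s) //= sf big1 ?addr0 // => t /eqP ts.
case: forallP => // tf; case: ts; apply/permP => i.
by rewrite (eqP (tf i)) (eqP (forallP sf i)).
Qed.

End CayleyPermanent.

(** * Gluing prefixes and suffixes into an identity matrix *)

Lemma cat_take_drop_map (T : Type) (n m : nat) (f g : 'I_n -> T) :
  take m (map f (enum 'I_n)) ++ drop m (map g (enum 'I_n)) =
  [seq if (i < m)%N then f i else g i | i : 'I_n <- enum 'I_n].
Proof.
rewrite -map_take -map_drop -[in RHS](cat_take_drop m (enum 'I_n)) map_cat.
congr cat; apply/eq_in_map => i /(map_f val) /=.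
  by rewrite map_take val_enum_ord take_iota mem_iota leq_min /= => /andP[->].
rewrite map_drop val_enum_ord drop_iota mem_iota => /andP[mi _].
by rewrite ltnNge mi.
Qed.

Lemma crossing_bound (K : fieldType) (X : choiceType) (n : nat)
    (pi : {perm 'I_n}) (x : 'I_n -> 'I_n -> X) (P : abp K X) (m : nat) :
  (forall i, pi (pi i) = i) -> (forall i, pi i != i) ->
  distinct_labels (loops_and_2cycles pi) x ->
  abp_poly P = cayley_perm K (loops_and_2cycles pi) x ->
  (2 ^ #|crossing pi m| <= abp_size P)%N.
Proof.
move=> piK pi_neq x_inj PE; pose C := crossing pi m.
pose word (T : {set 'I_n}) := [seq x i (swap piK T i) | i <- enum 'I_n].
pose I : finType := {T : {set 'I_n} | T \in powerset C}.
rewrite -card_powerset -card_sig.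
apply: (@abp_size_ge_fooling _ _ P I (fun T => take m (word (val T)))
  (fun T => drop m (word (val T)))) => T T'.
pose f (i : 'I_n) := if (i < m)%N then swap piK (val T) i else swap piK (val T') i.
have -> : take m (word (val T)) ++ drop m (word (val T')) =
    [seq x i (f i) | i <- enum 'I_n].
  rewrite cat_take_drop_map; apply: eq_map => i.
  by rewrite /f; case: ifP.
rewrite PE mcoeff_cayley_perm // => [|i]; last first.
  by rewrite /f; case: ifP => _; exact: swap_graph.
congr (nat_of_bool _)%:R; apply/existsP/eqP => [[s /forallP sf]|TT]; last first.
  by exists (swap piK (val T)); apply/forallP => i; rewrite /f -TT if_same.
have sub (U : I) : val U \subset C by rewrite -powersetE; exact: valP.
apply: val_inj; apply/setP => j.
have [jC|njC] := boolP (j \in C); last first.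
  rewrite (contraNF (subsetP (sub T) j) njC).
  by rewrite (contraNF (subsetP (sub T') j) njC).
have [<- _] := swap_crossing piK pi_neq (sub T) jC.
have [_ <-] := swap_crossing piK pi_neq (sub T') jC.
have [jm mpj] : (j < m)%N /\ (m <= pi j)%N.
  by move: jC; rewrite inE => /andP.
have sjE := eqP (sf j); have spjE := eqP (sf (pi j)).
rewrite /f jm in sjE; rewrite /f ltnNge mpj /= in spjE.
have := swap_graph piK (val T) j; have := swap_graph piK (val T') (pi j).
rewrite /loops_and_2cycles -sjE -spjE piK.
(* Injectivity of [s] on the pair: if [s j] is [pi j], then [s (pi j)] must be [j]; if [s j] is [j],
   then [s (pi j)] cannot be [j]. *)
case: (s j =P pi j) => [sj|_]; rewrite ?orbF.
  by rewrite -sj (inj_eq perm_inj) sj (negPf (pi_neq j)) /= => ->.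
move=> _ /eqP sj; apply/esym/negbTE/eqP => spj.
by have := pi_neq j; rewrite -(inj_eq (@perm_inj _ s)) sj spj eqxx.
Qed.

Theorem theorem3 (R : realType) :
  exists c : R, 0 < c /\
    forall (K : fieldType) (X : choiceType) (n : nat) (pi : {perm 'I_n})
      (x : 'I_n -> 'I_n -> X) (P : abp K X),
      ~~ odd n ->
      (forall i : 'I_n, pi (pi i) = i) ->
      (forall i : 'I_n, pi i != i) ->
      distinct_labels (loops_and_2cycles pi) x ->
      abp_poly P = cayley_perm K (loops_and_2cycles pi) x ->
      2 `^ (c * (cut pi)%:R) <= (abp_size P)%:R.
Proof.
exists 1; split=> // K X n pi x P _ piK pi_neq x_inj PE.
rewrite mul1r powR_mulrn // -natrX ler_nat.
(* For [n = 0] no position attains the maximum; the cut is 0 and the source is a node. *)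
have [n0|n_gt0] := posnP n.
  rewrite /cut big1 => [|k _]; last first.
    by case/eqP: (lt0n_neq0 (leq_ltn_trans (leq0n k) (ltn_ord k))).
  by rewrite expn0; apply/card_gt0P; exists (source P).
have [|k cutE] := @bigop.eq_bigmax _ (fun k => #|cut_at pi k|).
  by rewrite card_ord.
have [m le_m] := cut_at_crossing piK pi_neq k.
apply: leq_trans (crossing_bound m piK pi_neq x_inj PE).
by rewrite /cut cutE leq_exp2l.
Qed.
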